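(* Let $d,m\ge1$, $n=d+m$, let $\mathcal{U}\subset\mathbb{R}^d$ be open and let $\mathbf{f}=(f_1,\dots,f_m):\mathcal{U}\to\mathbb{R}^m$ be a $C^2$ map; set $\mathbf{F}(\mathbf{x})=(\mathbf{x},\mathbf{f}(\mathbf{x}))$ for $\mathbf{x}\in\mathcal{U}$. Let $\boldsymbol{\tau}=(\tau_1,\dots,\tau_n)\in\mathbb{R}_+^n$ satisfy $$\sum_{i=1}^n\tau_i=1\quad\text{and}\quad \min_{1\le i\le d}\tau_i\ \ge\ \max_{1\le j\le m}\tau_{d+j}.$$ Then $\mu_d\big(\mathbf{F}^{-1}(\mathbf{Bad}_n(\boldsymbol{\tau}))\big)=0$, where $\mu_d$ is Lebesgue measure on $\mathbb{R}^d$.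
   Context: $\mathbf{Bad}_n(\boldsymbol{\tau})$ denotes the set of $\mathbf{y}=(y_1,\dots,y_n)\in\mathbb{R}^n$ for which there exists $c>0$ such that for all $(p_1,\dots,p_n,q)\in\mathbb{Z}^n\times\mathbb{N}$ one has $|qy_i-p_i|\ge c\,q^{-\tau_i}$ for some $1\le i\le n$ (the $\boldsymbol{\tau}$-weighted badly approximable points). *)

(* Defs.v *)
From HB Require Import structures.
From mathcomp Require Import all_boot all_order all_algebra.
From mathcomp Require Import all_classical all_reals all_analysis.

Set Implicit Arguments.
Unset Strict Implicit.
Unset Printing Implicit Defensive.

Import Order.TTheory GRing.Theory Num.Theory.
Import numFieldNormedType.Exports.

Local Open Scope classical_set_scope.
Local Open Scope ring_scope.

Definition Bad (R : realType) (n : nat) (tau : 'rV[R]_n) : set 'rV[R]_n :=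
  [set y | exists2 c : R, 0 < c &
    forall (p : 'rV[int]_n) (q : nat), (0 < q)%N ->
      exists i : 'I_n,
        c * q%:R `^ (- tau 0 i) <= `|q%:R * y 0 i - (p 0 i)%:~R| ].

(* Meant for open [U] only: continuity and derivability at a point of [U] then
   do not depend on the values of [g] outside [U]. *)
Fixpoint Ck_on (R : realType) (d k : nat) (U : set 'rV[R]_d)
    (g : 'rV[R]_d -> R) : Prop :=
  (forall x, U x -> {for x, continuous g}) /\
  if k is k'.+1 then
    forall i : 'I_d,
      (forall x, U x -> derivable g x (delta_mx 0 i)) /\
      Ck_on k' U (fun x => 'D_(delta_mx 0 i) g x)
  else True.

Definition Ck_map_on (R : realType) (d m k : nat) (U : set 'rV[R]_d)
    (f : 'rV[R]_d -> 'rV[R]_m) : Prop :=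
  forall j : 'I_m, Ck_on k U (fun x => f x 0 j).

Definition box (R : realType) (d : nat) (a b : 'rV[R]_d) : set 'rV[R]_d :=
  [set x | forall i, a 0 i <= x 0 i <= b 0 i].

Definition box_volume (R : realType) (d : nat) (a b : 'rV[R]_d) : R :=
  \prod_(i < d) (b 0 i - a 0 i).

(* The Lebesgue outer measure on R^d, for d >= 1.  It is the Lebesgue measure on
   Lebesgue measurable sets, and a set has value 0 exactly when it is Lebesgue
   measurable with measure 0. *)
Definition lebesgue_rV (R : realType) (d : nat) (A : set 'rV[R]_d) : \bar R :=
  ereal_inf [set v : \bar R | exists a b : nat -> 'rV[R]_d,
    [/\ forall k i, a k 0 i <= b k 0 i,
        A `<=` \bigcup_k box (a k) (b k) &
        v = (\sum_(0 <= k <oo) (box_volume (a k) (b k))%:E)%E ] ].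

Definition graph_map (R : realType) (d m : nat) (f : 'rV[R]_d -> 'rV[R]_m)
    (x : 'rV[R]_d) : 'rV[R]_(d + m) :=
  row_mx x (f x).

(* Main.v *)
(** Fix [c > 0] and let [E] be the set of [x] in [U] at which [F x] is badly
    approximable with constant [c].  For [x] in [E] and [S] large, Dirichlet's
    theorem for the forms [q], [q x_i - p_i] and
    [q f_j(x) + sum_i d_i f_j(x) (p_i - q x_i) - p_{d+j}] gives an integer
    point with [q <= N S], the second forms at most [k S^-tau_i] and the third
    ones at most [k (N S)^-tau_{d+j}], where [k] is small compared to [c].
    Badness at [x] forces [q >= S].  As [tau_{d+j} <= tau_i], a first order
    expansion of [f_j] at [x] shows that no [x'] with
    [|x'_i - p_i/q| <= eta S^-(1+tau_i)] for all [i] lies in [E], while [p/q]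
    is within [S^-(1+tau_i)/8] of [x].  So [E] has, at every small scale, a
    hole of proportional size close to each of its points.  Splitting boxes of
    sides about [S^-(1+tau_i)] into boundedly many congruent boxes of the same
    kind for [T S], one of which misses [E], shows that [E] is covered by
    boxes of total volume [O(theta^k)] for every [k], with [theta < 1]. *)

Require Import Defs.
From HB Require Import structures.
From mathcomp Require Import all_boot all_order all_algebra.
From mathcomp Require Import all_classical all_reals all_analysis.
From mathcomp Require Import ring lra.

Set Implicit Arguments.
Unset Strict Implicit.
Unset Printing Implicit Defensive.

Import Order.TTheory GRing.Theory Num.Theory.
Import numFieldNormedType.Exports.

Local Open Scope classical_set_scope.
Local Open Scope ring_scope.

(** * The outer measure [lebesgue_rV] *)

Section lebesgue_rV_outer_measure.
Local Open Scope ereal_scope.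
Context (R : realType) (d : nat).
Implicit Types (a b : 'rV[R]_d.+1) (A : set 'rV[R]_d.+1).
Local Notation lambda := (@lebesgue_rV R d.+1).

Lemma box_volume_ge0 a b :
  (forall i, (a 0 i <= b 0 i)%R) -> (0 <= box_volume a b)%R.
Proof. by move=> ab; apply: prodr_ge0 => i _; rewrite subr_ge0. Qed.

Let box_volume_ge0E (a b : nat -> 'rV[R]_d.+1) :
  (forall k i, (a k 0 i <= b k 0 i)%R) ->
  forall k, 0 <= (box_volume (a k) (b k))%:E.
Proof. by move=> ab k; rewrite lee_fin box_volume_ge0. Qed.

Lemma lebesgue_rV_ge0 A : 0 <= lambda A.
Proof.
apply: le_ereal_inf_tmp => _ [a [b [ab _ ->]]].
by apply: nneseries_ge0 => k _ _; exact: box_volume_ge0E.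
Qed.

Lemma le_lebesgue_rV : {homo lambda : A B / A `<=` B >-> A <= B}.
Proof.
move=> A B AB; apply: le_ereal_inf => _ [a [b [ab Bab ->]]].
by exists a, b; split => //; exact: subset_trans Bab.
Qed.

Lemma lebesgue_rV_box a b : (forall i, (a 0 i <= b 0 i)%R) ->
  lambda (box a b) <= (box_volume a b)%:E.
Proof.
move=> ab.
(* The dimension is positive, so a degenerate box has volume zero and can pad the sequence. *)
have v0 : box_volume (0 : 'rV[R]_d.+1) 0 = 0%R.
  by rewrite /box_volume big_ord_recl !mxE subrr mul0r.
pose b' k : 'rV[R]_d.+1 := if k is 0%N then b else 0%R.
pose a' k : 'rV[R]_d.+1 := if k is 0%N then a else 0%R.
apply: ereal_inf_lbound; exists a', b'; split.
- by case=> [|k] i //=; rewrite !mxE.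
- by move=> x xab; exists 0%N.
- rewrite nneseries_recl//=; last first.
    by case=> [|k]/= *; rewrite lee_fin ?box_volume_ge0// => i; rewrite !mxE.
  rewrite eseries0 ?adde0// => -[|k]//= _ _.
  by rewrite v0.
Qed.

Lemma lebesgue_rV0 : lambda set0 = 0.
Proof.
apply/eqP; rewrite eq_le lebesgue_rV_ge0 andbT.
apply: (@le_trans _ _ (lambda (box 0 0))); first exact: le_lebesgue_rV.
apply: (le_trans (lebesgue_rV_box _)); first by [].
by rewrite lee_fin /box_volume big_ord_recl !mxE subrr mul0r.
Qed.

(** Covers of the [A n], each with excess at most [e / 2 ^ n.+1], are merged into one sequence
    through a bijection of [nat] with [nat * nat]. *)
Lemma lebesgue_rV_sigma_subadditive : sigma_subadditive lambda.
Proof.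
move=> A; have [[i ioo]|] := pselect (exists i, lambda (A i) = +oo).
  by rewrite (eseries_pinfty _ _ ioo) ?leey// => n _;
     rewrite -ltNye (lt_le_trans _ (lebesgue_rV_ge0 _)).
rewrite -forallNE => Afin.
apply/lee_addgt0Pr => e e0.
apply: le_trans; last first.
  exact: (epsilon_trick xpredT (fun n => lebesgue_rV_ge0 (A n)) (ltW e0)).
pose P n (ab : (nat -> 'rV[R]_d.+1) * (nat -> 'rV[R]_d.+1)) :=
  [/\ forall k i, (ab.1 k 0 i <= ab.2 k 0 i)%R,
      A n `<=` \bigcup_k box (ab.1 k) (ab.2 k) &
      \sum_(0 <= k <oo) (box_volume (ab.1 k) (ab.2 k))%:E <=
        lambda (A n) + (e / (2 ^ n.+1)%:R)%:E].
have [G PG] : {G & forall n, P n (G n)}.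
  apply: choice => n.
  have fin : lambda (A n) \is a fin_num.
    by rewrite ge0_fin_numE ?lebesgue_rV_ge0// ltey; apply/eqP/Afin.
  have en0 : (0 < e / (2 ^ n.+1)%:R)%R by rewrite divr_gt0// ltr0n expn_gt0.
  have [_ [a [b [ab Aab ->]]] /ltW le] := lb_ereal_inf_adherent en0 fin.
  by exists (a, b); split.
have ab k : forall i, ((G k.1).1 k.2 0 i <= (G k.1).2 k.2 0 i)%R.
  by move=> i; have [+ _ _] := PG k.1; apply.
have /card_esym/ppcard_eqP[f] := card_nat2.
pose v k := (box_volume ((G k.1).1 k.2) ((G k.1).2 k.2))%:E.
have v0 k : 0 <= v k by rewrite lee_fin box_volume_ge0.
apply: (@le_trans _ _ (\sum_(0 <= n <oo) \sum_(0 <= k <oo) v (n, k))); last first.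
  apply: lee_nneseries => n _; first by move=> *; exact: nneseries_ge0.
  by have [] := PG n.
have -> : \sum_(0 <= n <oo) \sum_(0 <= k <oo) v (n, k) = \sum_(0 <= k <oo) v (f k).
  rewrite !nneseries_esumT//; last by move=> *; exact: nneseries_ge0.
  under eq_esum do rewrite nneseries_esumT//.
  rewrite esum_esum//=.
  rewrite (reindex_esum setT _ f); last first.
    rewrite [X in set_bij _ X _](_ : _ = setT) //.
    by apply/seteqP; split.
  by apply: eq_esum => k _; congr v; case: (f k).
apply: ereal_inf_lbound.
exists (fun k => (G (f k).1).1 (f k).2), (fun k => (G (f k).1).2 (f k).2).
split=> // x [n _ Anx]; have [_ /(_ _ Anx) [k _ xk] _] := PG n.
by exists (f^-1%FUN (n, k)) => //=; rewrite invK ?inE.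
Qed.

HB.instance Definition _ := isOuterMeasure.Build R _ lambda
  lebesgue_rV0 lebesgue_rV_ge0 le_lebesgue_rV lebesgue_rV_sigma_subadditive.

Lemma lebesgue_rV_countable_cover (I : countType) A (F : I -> set 'rV[R]_d.+1) :
  A `<=` \bigcup_i F i -> (forall i, lambda (F i) = 0) -> lambda A = 0.
Proof.
move=> AF F0; apply/eqP; rewrite eq_le lebesgue_rV_ge0 andbT.
(* Codes that decode to no index contribute the empty set. *)
pose F' n := if @unpickle I n is Some i then F i else set0.
apply: (@le_trans _ _ (lambda (\bigcup_n F' n))).
  apply: le_lebesgue_rV => x /AF[i _ Fix].
  by exists (pickle i) => //; rewrite /F' pickleK.
apply: (le_trans (lebesgue_rV_sigma_subadditive _)).
rewrite eseries0// => n _ _; rewrite /F'.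
by case: unpickle => [i|]; rewrite ?F0 ?lebesgue_rV0.
Qed.

Lemma lebesgue_rV_finite_cover (I : finType) (P : pred I) A
    (F : I -> set 'rV[R]_d.+1) :
  (forall x, A x -> exists2 i, P i & F i x) ->
  lambda A <= \sum_(i | P i) lambda (F i).
Proof.
move=> AF; pose G n := nth set0 [seq F i | i <- enum P] n.
apply: (@le_trans _ _ (lambda (\big[setU/set0]_(n < #|P|) G n))).
  apply: le_lebesgue_rV => x /AF[i Pi Fix].
  rewrite -bigcup_mkord; exists (index i (enum P)).
    by rewrite /= cardE index_mem mem_enum.
  by rewrite /G (nth_map i) ?index_mem ?nth_index ?mem_enum.
apply: (le_trans (outer_measure_subadditive _ _ _)).
rewrite -(big_enum _ _ P) /= -(big_mkord xpredT (fun n => lambda (G n))).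
rewrite -(big_map F xpredT lambda) (big_nth set0) size_map cardE.
exact: lexx.
Qed.

End lebesgue_rV_outer_measure.

(** * Porous sets are null *)

Section porous_sets.
Context (R : realType) (d : nat).
Local Notation lambda := (@lebesgue_rV R d.+1).

Lemma grid_cell (n : nat) (a h x : R) : (0 < n)%N ->
  a <= x <= a + n%:R * h ->
  exists2 j, (j < n)%N & a + j%:R * h <= x <= a + j.+1%:R * h.
Proof.
elim: n => // n IHn _ /andP[ax xn].
have [xlt|nle] := ltP x (a + n%:R * h); last by exists n; rewrite ?nle.
have [n0|n0] := posnP n.
  by move: (le_lt_trans ax xlt); rewrite n0 mul0r addr0 ltxx.
have [|j jn jx] := IHn n0; first by rewrite ax ltW.
by exists j => //; exact: ltnW.
Qed.

(** * Subdivision of a box into a grid of congruent cells *)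

Section grid.
Variables (a b : 'rV[R]_d.+1) (n : 'I_d.+1 -> nat).
Hypothesis n0 : forall i, (0 < n i)%N.

(** The number of cells depends on the coordinate; index tuples are therefore maps into the common
    ['I_N], restricted by [family]. *)
Let N := \max_i n i.
Let h i := (b 0 i - a 0 i) / (n i)%:R.
Let cells := family (fun (i : 'I_d.+1) (j : 'I_N) => (j < n i)%N).
Let cell (g : {ffun 'I_d.+1 -> 'I_N}) : set 'rV[R]_d.+1 :=
  box (\row_i (a 0 i + (g i)%:R * h i)) (\row_i (a 0 i + (g i).+1%:R * h i)).

Let box_cell x : box a b x -> exists2 g, g \in cells & cell g x.
Proof.
move=> abx.
have /choice[g gP] (i : 'I_d.+1) : exists j : 'I_N, (j < n i)%N /\
    a 0 i + j%:R * h i <= x 0 i <= a 0 i + j.+1%:R * h i.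
  have [|j jn jx] := @grid_cell (n i) (a 0 i) (h i) (x 0 i) (n0 i).
    by rewrite mulrCA divff ?mulr1 ?pnatr_eq0 ?gtn_eqF// addrCA subrr addr0 abx.
  have jN : (j < N)%N by rewrite (leq_trans jn) ?leq_bigmax.
  by exists (Ordinal jN).
exists (finfun g).
  by apply/familyP => i; rewrite ffunE; have [] := gP i.
by move=> i; rewrite !mxE ffunE; have [] := gP i.
Qed.

Let sum_cells (c : R) :
  \sum_(g in cells) c * \prod_i h i = c * box_volume a b.
Proof.
rewrite -mulr_sumr; congr (c * _).
rewrite -(bigA_distr_big_dep (fun i (j : 'I_N) => (j < n i)%N) (fun i _ => h i)).
apply: eq_bigr => i _.
rewrite -(big_ord_widen N (fun=> h i)) ?leq_bigmax// sumr_const card_ord.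
by rewrite -mulr_natr divfK// pnatr_eq0 gtn_eqF.
Qed.

(* By the second hypothesis, the grid cell containing [z] misses [A]. *)
Lemma lebesgue_rV_grid (A : set 'rV[R]_d.+1) (c : R) :
  (forall a' b' : 'rV[R]_d.+1, (forall i, b' 0 i - a' 0 i = h i) ->
     (lambda (A `&` box a' b') <= (c * box_volume a' b')%:E)%E) ->
  (exists2 z, box a b z &
     forall x, A x -> exists i, h i < `|x 0 i - z 0 i|) ->
  (lambda (A `&` box a b) <=
    (c * (1 - (\prod_i (n i)%:R)^-1) * box_volume a b)%:E)%E.
Proof.
move=> cellA [z abz zA]; have [g0 g0c g0z] := box_cell abz.
have cell_width (g : {ffun 'I_d.+1 -> 'I_N}) i : (\row_i (a 0 i + (g i).+1%:R * h i) : 'rV[R]_d.+1) 0 i -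
    (\row_i (a 0 i + (g i)%:R * h i) : 'rV[R]_d.+1) 0 i = h i.
  by rewrite !mxE -natr1; ring.
have cell_vol g : (lambda (A `&` cell g) <= (c * \prod_i h i)%:E)%E.
  have := cellA _ _ (cell_width g).
  by rewrite /box_volume (eq_bigr _ (fun i _ => cell_width g i)).
(* The cell of [z] has side [h i] in each coordinate, so its points are too close to [z] to lie in
   [A]. *)
have A0 : A `&` cell g0 = set0.
  rewrite -subset0 => x [Ax g0x]; have [i] := zA x Ax.
  have := g0x i; have := g0z i; rewrite !mxE -natr1 => /andP[? ?] /andP[? ?].
  by rewrite ltNge ler_distlC => /negP; apply; apply/andP; split; lra.
apply: (@le_trans _ _ (\sum_(g in cells) lambda (A `&` cell g))%E).
  apply: lebesgue_rV_finite_cover => x [Ax /box_cell[g gc gx]].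
  by exists g.
rewrite (bigD1 g0)//= A0 lebesgue_rV0 add0e.
apply: (@le_trans _ _ (\sum_(g in cells | g != g0) (c * \prod_i h i)%:E)%E).
  by apply: lee_sum => g _; exact: cell_vol.
rewrite sumEFin lee_fin.
(* Dropping one of [\prod_i n i] equal terms produces the factor [1 - (\prod_i n i)^-1]. *)
have := sum_cells c; rewrite (bigD1 g0)//= => /(canRL (addKr _)) ->.
rewrite le_eqVlt; apply/orP; left; apply/eqP.
rewrite /box_volume prodf_div; ring.
Qed.

End grid.

Lemma exists_expr_lt (t e : R) : 0 <= t < 1 -> 0 < e -> exists k, t ^+ k <= e.
Proof.
move=> /andP[t0 t1] e0.
have : t ^+ k @[k --> \oo] --> (0 : R) by apply: cvg_expr; rewrite ger0_norm.
move=> /cvgrPdist_le /(_ e e0) [k _ /(_ k (leqnn k))] /=.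
by rewrite sub0r normrN ger0_norm ?exprn_ge0//; exists k.
Qed.

(** * Anisotropic porosity and the decay of covers *)

Section porous.
Variables (A : set 'rV[R]_d.+1) (sigma : 'I_d.+1 -> R) (S0 eta : R).
Let w S i := S `^ (- sigma i).

Hypotheses (sigma_ge1 : forall i, 1 <= sigma i) (S0_gt0 : 0 < S0)
  (eta_gt0 : 0 < eta).
Hypothesis holes : forall x S, A x -> S0 <= S -> exists2 z : 'rV[R]_d.+1,
  forall i, `|x 0 i - z 0 i| <= w S i / 8 &
  forall x', A x' -> exists i, eta * w S i < `|x' 0 i - z 0 i|.

Let w_gt0 S i : 0 < S -> 0 < w S i.
Proof. exact: powR_gt0. Qed.

(** The factor 2 leaves room for rounding: a box can be cut into a whole number of cells that are
    admissible at a finer scale. *)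
Let admissible S (a b : 'rV[R]_d.+1) :=
  forall i, w S i <= b 0 i - a 0 i <= 2 * w S i.

(* A point of [A] close to the centre of a box provides a hole well inside the
   box; if there is no such point, then the centre itself lies in a hole. *)
Let hole_in_box a b S : S0 <= S -> admissible S a b ->
  exists2 z, box a b z & forall x, A x ->
    exists i, Num.min eta 8^-1 * w S i < `|x 0 i - z 0 i|.
Proof.
move=> S0S adm; have Sgt0 : 0 < S by exact: lt_le_trans S0S.
pose m : 'rV[R]_d.+1 := \row_i ((a 0 i + b 0 i) / 2).
have [[x [Ax xm]]|noA] := pselect (exists x, A x /\
    forall i, `|x 0 i - m 0 i| <= w S i / 8).
- have [z xz zA] := holes Ax S0S; exists z.
    (* [z] is within [w S i / 4] of the centre, while half a side is at least [w S i / 2]. *)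
    move=> i; have := xz i; have := xm i; have := adm i; have := w_gt0 i Sgt0.
    by rewrite mxE !ler_distlC => *; lra.
  move=> x' /zA[i lti]; exists i; apply: le_lt_trans lti.
  by rewrite ler_wpM2r ?ge_min ?lexx// ltW ?w_gt0.
- exists m.
    by move=> i; have := adm i; have := w_gt0 i Sgt0; rewrite mxE => *; lra.
  move=> x Ax; apply: contrapT => /forallNP xm; apply: noA; exists x.
  split=> // i; move/negP: (xm i); rewrite -leNgt => /le_trans; apply.
  rewrite mulrC ler_wpM2l ?ge_min ?lexx ?orbT// ltW ?w_gt0//.
Qed.

(** As [1 <= sigma i], this choice gives [2 * w T i <= Num.min eta 8^-1]: a cell admissible at scale
    [T * S] that contains the centre of a hole at scale [S] lies inside that hole. [B] bounds the
    number of cells in one subdivision. *)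
Let T := 2 / Num.min eta 8^-1.
Let B := \prod_i (2 / w T i).

Let min_gt0 : 0 < Num.min eta 8^-1.
Proof. by rewrite lt_min eta_gt0/= invr_gt0. Qed.

Let T_ge1 : 1 <= T.
Proof.
rewrite /T ler_pdivlMr// mul1r ge_min; apply/orP; right; lra.
Qed.

Let T_gt0 : 0 < T.
Proof. exact: lt_le_trans T_ge1. Qed.

Let wT_le i : 2 * w T i <= Num.min eta 8^-1.
Proof.
rewrite mulrC -ler_pdivlMr//.
have -> : Num.min eta 8^-1 / 2 = T `^ (-1) by rewrite powR_inv1 ?invf_div// ltW.
by rewrite /w ler_powR ?T_ge1// lerN2.
Qed.

Let wT_le1 i : w T i <= 1.
Proof.
have := wT_le i; rewrite le_min => /andP[_]; have := w_gt0 i T_gt0; lra.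
Qed.

Let B_gt1 : 1 < B.
Proof.
rewrite /B; apply: (@lt_le_trans _ _ (\prod_(i < d.+1) 2)).
  by rewrite prodr_const card_ord exprn_egt1// ltr1n.
apply: ler_prod => i _; rewrite ler0n/= ler_pdivlMr ?w_gt0//.
have := wT_le1 i; lra.
Qed.

(** Induction on [k] over all scales at once: one cell misses [A], and the others, admissible at
    scale [T * S], obey the bound for [k]. There are at most [B] cells, so each round gains the
    factor [1 - B^-1]. *)
Let box_decay k : forall S a b, S0 <= S -> admissible S a b ->
  (lambda (A `&` box a b) <= ((1 - B^-1) ^+ k * box_volume a b)%:E)%E.
Proof.
have B0 : 0 < B by exact: lt_trans B_gt1.
have th0 : 0 <= 1 - B^-1 by rewrite subr_ge0 invf_le1// ltW.
elim: k => [|k IHk] S a b S0S adm.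
  rewrite expr0 mul1r; apply: le_trans (lebesgue_rV_box _).
    by apply: le_lebesgue_rV; exact: subIsetr.
  move=> i; have := adm i; have := w_gt0 i (lt_le_trans S0_gt0 S0S); lra.
have Sgt0 : 0 < S by exact: lt_le_trans S0S.
have wM i : w (T * S) i = w T i * w S i by rewrite /w powRM// ltW.
have ab i : a 0 i <= b 0 i by have := adm i; have := w_gt0 i Sgt0; lra.
(* Rounding [r i] down to [n i >= 1] gives cells of side between [w (T * S) i] and twice that, as
   [r i < n i + 1 <= 2 * n i]. *)
pose r i := (b 0 i - a 0 i) / w (T * S) i.
pose n i := Num.truncn (r i).
have wTS i : 0 < w (T * S) i by rewrite w_gt0// mulr_gt0.
have r1 i : 1 <= r i.
  rewrite ler_pdivlMr// mul1r wM; have /andP[+ _] := adm i.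
  by apply: le_trans; rewrite ler_piMl// ltW ?w_gt0.
have n0 i : (0 < n i)%N by rewrite truncn_gt0.
have n0R i : 0 < (n i)%:R :> R by rewrite ltr0n.
have /all_and2[nr rn] i : (n i)%:R <= r i /\ r i < (n i).+1%:R.
  by apply/andP; apply: truncn_itv; exact: le_trans (r1 i).
have h_ge i : w (T * S) i <= (b 0 i - a 0 i) / (n i)%:R.
  by rewrite ler_pdivlMr// mulrC -ler_pdivlMr.
have h_le i : (b 0 i - a 0 i) / (n i)%:R <= 2 * w (T * S) i.
  rewrite ler_pdivrMr// mulrAC -ler_pdivrMr// (le_trans (ltW (rn i)))//.
  have : 1 <= (n i)%:R :> R by rewrite ler1n.
  by rewrite -natr1; lra.
have [z abz zA] := hole_in_box S0S adm.
have S0TS : S0 <= T * S by rewrite (le_trans S0S)// ler_peMl// ltW.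
apply: (@le_trans _ _
  ((1 - B^-1) ^+ k * (1 - (\prod_i (n i)%:R)^-1) * box_volume a b)%:E).
  apply: lebesgue_rV_grid => //.
- move=> a' b' h'; apply: IHk S0TS _ => i.
  by rewrite h' h_ge h_le.
- exists z => // x /zA[i lti]; exists i; apply: le_lt_trans lti.
  rewrite (le_trans (h_le i))// wM mulrA ler_wpM2r// ltW ?w_gt0//.
rewrite lee_fin exprSr -!mulrA ler_wpM2l ?exprn_ge0// ler_wpM2r//.
  exact: box_volume_ge0.
have n_gt0 : 0 < \prod_i (n i)%:R :> R by apply: prodr_gt0.
rewrite lerB// lef_pV2// /B; apply: ler_prod => i _.
rewrite ltW//= (le_trans (nr i))// /r wM invfM mulrA mulrAC ler_wpM2r//.
  by rewrite invr_ge0 ltW ?w_gt0.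
by rewrite ler_pdivrMr ?w_gt0//; have /andP[] := adm i.
Qed.

Let box_null S a b : S0 <= S -> admissible S a b -> lambda (A `&` box a b) = 0%E.
Proof.
move=> S0S adm; apply/eqP; rewrite eq_le lebesgue_rV_ge0 andbT.
have ab i : a 0 i <= b 0 i.
  by have := adm i; have := w_gt0 i (lt_le_trans S0_gt0 S0S); lra.
apply/lee_addgt0Pr => e e0; rewrite add0e.
have v0 := box_volume_ge0 ab; have v1 : 0 < box_volume a b + 1 by lra.
have B0 : 0 < B by exact: lt_trans B_gt1.
have th : 0 <= 1 - B^-1 < 1.
  by rewrite subr_ge0 invf_le1// (ltW B_gt1)/= gtrBl invr_gt0.
have [k kP] := exists_expr_lt th (divr_gt0 e0 v1).
apply: (le_trans (box_decay k S0S adm)); rewrite lee_fin.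
apply: (@le_trans _ _ (e / (box_volume a b + 1) * box_volume a b)).
  by rewrite ler_wpM2r.
by rewrite mulrAC ler_pdivrMr// ler_pM2l//; lra.
Qed.

Lemma lebesgue_rV_porous : lambda A = 0%E.
Proof.
(* Lattice boxes with sides [w S0 i] are admissible at scale [S0], and countably many of them fill
   the space. *)
pose C (z : 'rV[int]_d.+1) : set 'rV[R]_d.+1 :=
  box (\row_i ((z 0 i)%:~R * w S0 i)) (\row_i (((z 0 i)%:~R + 1) * w S0 i)).
apply: (@lebesgue_rV_countable_cover _ _ _ _ (fun z => A `&` C z)).
  move=> x Ax; exists (\row_i Num.floor (x 0 i / w S0 i)) => //; split=> // i.
  have w0 := w_gt0 i S0_gt0.
  have /andP[] := floor_itv (x 0 i / w S0 i).
  rewrite intrD1 ler_pdivlMr// ltr_pdivrMr// => x1 /ltW x2.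
  by rewrite !mxE x1 x2.
move=> z; apply: (@box_null S0) => // i.
have := w_gt0 i S0_gt0.
by rewrite !mxE mulrDl mul1r addrAC subrr add0r => w0; rewrite lexx/=; lra.
Qed.

End porous.

End porous_sets.

(** * Dirichlet's theorem *)

(** The [M.+1] indices from 0 to [M] share at most [M] possible value vectors, so two of them
    collide. *)
Lemma pigeonhole_family (I : finType) (n : I -> nat) (M : nat)
    (c : nat -> I -> nat) :
  (forall q i, c q i < n i)%N -> (\prod_i n i <= M)%N ->
  exists q1 q2, [/\ (q1 < q2)%N, (q2 <= M)%N & forall i, c q1 i = c q2 i].
Proof.
move=> cn nM; pose N := \max_i n i.
have cN q i : (c q i < N)%N by apply: leq_trans (cn q i) _; exact: leq_bigmax.
pose cells := family (fun (i : I) (j : 'I_N) => (j < n i)%N).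
pose F (q : 'I_M.+1) : {ffun I -> 'I_N} := [ffun i => Ordinal (cN q i)].
have cells_card : #|cells| = (\prod_i n i)%N.
  rewrite -sum1_card.
  transitivity (\sum_(g in cells) \prod_(i : I) 1)%N.
    by apply: eq_bigr => g _; rewrite big1.
  rewrite -(bigA_distr_big_dep (fun i (j : 'I_N) => (j < n i)%N) (fun _ _ => 1%N)).
  apply: eq_bigr => i _.
  rewrite -(big_ord_widen N (fun=> 1%N)) ?leq_bigmax//.
  by rewrite sum1_card card_ord.
have /injectivePn[q1 [q2 q12 Fq]] : ~~ injectiveb F.
  apply/negP => /injectiveP/card_codom; rewrite card_ord => FM.
  suff : (#|codom F| <= #|cells|)%N.
    by rewrite FM cells_card ltnNge nM.
  apply: subset_leq_card; apply/fintype.subsetP => _ /codomP[q ->].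
  by apply/familyP => i; rewrite ffunE; exact: cn.
have cE i : c q1 i = c q2 i.
  by have := congr1 (fun g : {ffun I -> 'I_N} => val (g i)) Fq; rewrite !ffunE.
have [q12'|q21|/val_inj/eqP] := ltngtP q1 q2; last by rewrite (negbTE q12).
- by exists q1, q2; split => //; rewrite -ltnS.
- by exists q2, q1; split => //; rewrite -ltnS.
Qed.

(** Coordinate [i] is cut into intervals of length [r i]; at most [1 / r i + 1 <= 2 / r i] of them
    are used, which is the source of the factor 2. *)
Lemma pigeonhole_unit_cube (R : realType) (I : finType) (r : I -> R) (M : nat)
    (u : nat -> I -> R) :
  (forall i, 0 < r i <= 1) -> (forall q i, 0 <= u q i < 1) ->
  \prod_i (2 / r i) <= M%:R ->
  exists q1 q2, [/\ (q1 < q2)%N, (q2 <= M)%N &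
    forall i, `|u q2 i - u q1 i| <= r i].
Proof.
move=> r01 u01 rM.
have r0 i : 0 < r i by have /andP[] := r01 i.
have ur0 q i : 0 <= u q i / r i.
  by have /andP[? _] := u01 q i; rewrite divr_ge0// ltW.
pose c q i := Num.truncn (u q i / r i).
have [||q1 [q2 [q12 q2M cE]]] :=
    @pigeonhole_family I (fun i => (Num.truncn (r i)^-1).+1) M c.
- move=> q i; rewrite ltnS; apply: le_truncn.
  by rewrite -[leRHS]mul1r ler_wpM2r ?invr_ge0 ?ltW//; have /andP[] := u01 q i.
- rewrite -(ler_nat R) natr_prod (le_trans _ rM)//.
  apply: ler_prod => i _; rewrite ler0n/= -natr1.
  have r1 : 1 <= (r i)^-1 by rewrite invf_ge1//; have /andP[] := r01 i.
  have /andP[] : ((Num.truncn (r i)^-1)%:R <= (r i)^-1 < (Num.truncn (r i)^-1).+1%:R).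
    by rewrite truncn_itv// (le_trans _ r1).
  lra.
exists q1, q2; split => // i.
have /andP[a1 b1] := truncn_itv (ur0 q1 i).
have /andP[a2 b2] := truncn_itv (ur0 q2 i).
rewrite -/(c _ _) -natr1 in a1 b1; rewrite -/(c _ _) -cE -natr1 in a2 b2.
move: a1 b1 a2 b2; rewrite !ler_pdivlMr// !ltr_pdivrMr// => *.
by rewrite ler_distlC; apply/andP; split; lra.
Qed.

(* A triangular system of linear forms needs only Dirichlet's pigeonhole
   argument: [p] and then [p'] can be chosen as integer parts. *)
Lemma dirichlet_triangular (R : realType) (d m : nat) (x : 'I_d -> R)
    (y : 'I_m -> R) (G : 'I_m -> 'I_d -> R) (r : 'I_d -> R) (s : 'I_m -> R)
    (M : nat) :
  (forall i, 0 < r i <= 1) -> (forall j, 0 < s j <= 1) ->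
  \prod_i (2 / r i) * \prod_j (2 / s j) <= M%:R ->
  exists (q : nat) (p : 'I_d -> int) (p' : 'I_m -> int),
  [/\ (0 < q <= M)%N, forall i, `|q%:R * x i - (p i)%:~R| <= r i &
      forall j, `|q%:R * y j + \sum_i G j i * ((p i)%:~R - q%:R * x i)
                  - (p' j)%:~R| <= s j].
Proof.
move=> r01 s01 rsM.
(* The first forms are rounded by [P], and these integers enter [L] before it is rounded in turn;
   all coordinates of [u] are then fractional parts. *)
pose P (q : nat) i := Num.floor (q%:R * x i).
pose L (q : nat) j := q%:R * y j + \sum_i G j i * ((P q i)%:~R - q%:R * x i).
pose u (q : nat) (k : 'I_d + 'I_m) := match k with
  | inl i => q%:R * x i - (P q i)%:~R
  | inr j => L q j - (Num.floor (L q j))%:~R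
  end.
have [|||q1 [q2 [q12 q2M uP]]] := @pigeonhole_unit_cube R ('I_d + 'I_m)%type
    (fun k => match k with inl i => r i | inr j => s j end) M u.
- by case.
- by move=> q [i|j] /=; rewrite subr_ge0 ltrBlDl -[X in _ + X]mulr1z -intrD floor_itv.
- by rewrite big_sumType.
exists (q2 - q1)%N, (fun i => P q2 i - P q1 i),
  (fun j => Num.floor (L q2 j) - Num.floor (L q1 j)).
rewrite subn_gt0 q12 (leq_trans (leq_subr _ _) q2M) natrB 1?ltnW//; split=> //.
- move=> i; have := uP (inl i); rewrite /u intrB.
  by apply: le_trans; rewrite le_eqVlt; apply/orP; left; apply/eqP; congr `|_|; ring.
- move=> j; have := uP (inr j); rewrite /u intrB.
  apply: le_trans; rewrite le_eqVlt; apply/orP; left; apply/eqP; congr `|_|.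
  rewrite /L.
  (* [L] is linear in [q] and [P q], so a difference of its values is the form at the difference
     vector. *)
  rewrite (eq_bigr (fun i => G j i * ((P q2 i)%:~R - q2%:R * x i)
    - G j i * ((P q1 i)%:~R - q1%:R * x i))).
    by rewrite sumrB; ring.
  by move=> i _; rewrite intrB; ring.
Qed.

(** * First order expansion from continuous partial derivatives *)

Section first_order_expansion.
Context (R : realType) (d : nat).

(** By the mean value theorem the left side is [|dg c - D| * |t|] for some [c] between 0 and [t]. *)
Lemma MVT_expansion (g dg : R -> R) (D e t : R) :
  (forall s : R, `|s| <= `|t| -> is_derive s 1 g (dg s)) ->
  (forall s, `|s| <= `|t| -> `|dg s - D| <= e) ->
  `|g t - g 0 - D * t| <= e * `|t|.
Proof.
move=> gd dgD.
have cont a b : (forall s, s \in `[a, b] -> `|s| <= `|t|) ->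
    {within `[a, b], continuous g}.
  move=> abt; apply: derivable_within_continuous => s /abt/gd ds.
  exact: ex_derive.
have [t0|t0] := leP 0 t.
- have st s : s \in `[0, t] -> `|s| <= `|t|.
    by rewrite in_itv/= => /andP[s0 ?]; rewrite !ger0_norm.
  have [s|c ct ->] := @MVT_segment _ g dg 0 t t0 _ (cont _ _ st).
    by move=> /subset_itv_oo_cc/st; exact: gd.
  by rewrite subr0 -mulrBl normrM ler_wpM2r// dgD// st.
- have st s : s \in `[t, 0] -> `|s| <= `|t|.
    rewrite in_itv/= => /andP[ts s0].
    by rewrite (ler0_norm s0) (ltr0_norm t0) lerN2.
  have [s|c ct gE] := @MVT_segment _ g dg t 0 (ltW t0) _ (cont _ _ st).
    by move=> /subset_itv_oo_cc/st; exact: gd.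
  rewrite (_ : g t - g 0 - D * t = (dg c - D) * t).
    by rewrite normrM ler_wpM2r// dgD// st.
  by move: gE; rewrite sub0r => gE; rewrite -[g t - _]opprB gE; ring.
Qed.

Lemma is_derive_along (V : normedModType R) (f : V -> R) (z v : V) (s : R) :
  derivable f (z + s *: v) v ->
  is_derive s 1 (fun t => f (z + t *: v)) ('D_v f (z + s *: v)).
Proof.
move=> df.
have E : (fun h => h^-1 *: (((fun t => f (z + t *: v)) \o shift s) (h *: 1)
            - f (z + s *: v))) =
    (fun h => h^-1 *: ((f \o shift (z + s *: v)) (h *: v) - f (z + s *: v))).
  apply/funext => h /=; congr (_ *: (f _ - _)).
  by rewrite [h *: 1]mulr1 scalerDl addrCA addrA.
by split; rewrite /derivable /derive E.
Qed.

(** One coordinate is changed at a time on the way from [x] to [y]; the increments telescope, and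
    each is a one-variable expansion. *)
Lemma partials_expansion (f : 'rV[R]_d -> R) (U : set 'rV[R]_d) (x : 'rV[R]_d)
    (e : R) :
  open U -> U x -> 0 < e ->
  (forall i z, U z -> derivable f z (delta_mx 0 i)) ->
  (forall i, {for x, continuous ('D_(delta_mx 0 i) f)}) ->
  exists2 r : R, 0 < r & forall y : 'rV[R]_d, (forall i, `|y 0 i - x 0 i| < r) ->
    `|f y - f x - \sum_i 'D_(delta_mx 0 i) f x * (y 0 i - x 0 i)|
      <= e * \sum_i `|y 0 i - x 0 i|.
Proof.
move=> U_open Ux e0 df cf.
have near_D : \forall z \near x,
    forall i, `|'D_(delta_mx 0 i) f z - 'D_(delta_mx 0 i) f x| <= e.
  suff H i : \forall z \near x,
      `|'D_(delta_mx 0 i) f z - 'D_(delta_mx 0 i) f x| <= e.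
    exact: (filter_forall (nbhs_filter x) H).
  move/cvgrPdist_le : (cf i) => /(_ e e0).
  by apply: filterS => z; rewrite distrC.
have near_U : \forall z \near x, U z by exact: open_nbhs_nbhs.
have near_UD : nbhs x (U `&` [set z | forall i,
    `|'D_(delta_mx 0 i) f z - 'D_(delta_mx 0 i) f x| <= e]) by exact: filterI.
have [r /= r0 near_x] := iffLR (nbhs_ballP x _) near_UD.
exists r => // y yx.
pose Y k : 'rV[R]_d := \row_i (if (i < k)%N then y 0 i else x 0 i).
have Y0 : Y 0%N = x by apply/rowP => i; rewrite mxE.
have Yd : Y d = y by apply/rowP => i; rewrite mxE ltn_ord.
have YS (i : 'I_d) : Y i.+1 = Y i + (y 0 i - x 0 i) *: delta_mx 0 i.
  apply/rowP => k; rewrite !mxE eqxx/= ltnS.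
  have [->|ki] := eqVneq k i; first by rewrite leqnn ltnn mulr1 addrC subrK.
  by rewrite mulr0 addr0 leq_eqVlt val_eqE (negbTE ki).
have -> : f y - f x = \sum_(i < d) (f (Y i.+1) - f (Y i)).
  by rewrite -[in LHS]Y0 -[in LHS]Yd -(telescope_sumr (f \o Y)) // big_mkord.
rewrite -sumrB mulr_sumr; apply: (le_trans (ler_norm_sum _ _ _)).
apply: ler_sum => i _; rewrite YS.
set t := y 0 i - x 0 i.
(* Balls of row vectors are coordinatewise, so every segment of the path stays where the partial
   derivatives are controlled. *)
have Yball s : `|s| <= `|t| -> ball x r (Y i + s *: delta_mx 0 i).
  move=> st; split=> // k l; rewrite ord1 /ball/= !mxE eqxx/=.
  have [->|ki] := eqVneq l i.
    rewrite ltnn mulr1 opprD addrA subrr sub0r normrN.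
    exact: le_lt_trans st (yx i).
  rewrite mulr0 addr0; case: ifP => _; last by rewrite subrr normr0.
  by rewrite distrC.
have := @MVT_expansion (fun s => f (Y i + s *: delta_mx 0 i))
  (fun s => 'D_(delta_mx 0 i) f (Y i + s *: delta_mx 0 i))
  ('D_(delta_mx 0 i) f x) e t.
rewrite scale0r addr0; apply.
- move=> s /Yball/near_x[Us _]; apply: is_derive_along; exact: df.
- by move=> s /Yball/near_x[_].
Qed.

End first_order_expansion.

(** * Weighted Dirichlet's theorem and holes near badly approximable points *)

Section weighted_dirichlet.
Context (R : realType).

Lemma gt0_powRD (x r s : R) : 0 < x -> x `^ (r + s) = x `^ r * x `^ s.
Proof. by move=> x0; rewrite powRD// (gt_eqF x0) implybT. Qed.

Lemma prod_mul_powR (I : finType) (c S : R) (a : I -> R) : 0 < S ->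
  \prod_i (c * S `^ a i) = c ^+ #|I| * S `^ (\sum_i a i).
Proof.
move=> S0; rewrite big_split/= prodr_const; congr (_ * _).
elim/big_rec2: _ => [|i u v _ ->]; first by rewrite powRr0.
by rewrite gt0_powRD.
Qed.

Lemma le_powRN (u v e : R) : 0 < u -> u <= v -> 0 <= e -> v `^ (- e) <= u `^ (- e).
Proof.
move=> u0 uv e0; have v0 := lt_le_trans u0 uv.
by rewrite !powRN lef_pV2 ?posrE ?powR_gt0// ge0_ler_powR ?nnegrE// ltW.
Qed.

(** This turns powers of a scale [S] into powers of a denominator [q <= N * S], at the cost of a
    factor [N]. *)
Lemma powRN_le_mul (u v N e : R) : 0 < u -> 0 < v -> 1 <= N -> v <= N * u ->
  0 <= e <= 1 -> u `^ (- e) <= N * v `^ (- e).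
Proof.
move=> u0 v0 N1 vNu /andP[e0 e1]; have N0 : 0 < N by exact: lt_le_trans N1.
apply: (@le_trans _ _ (N `^ e * (N * u) `^ (- e))).
  have Ne0 : N `^ e != 0 by rewrite gt_eqF// powR_gt0.
  by rewrite (powRM _ (ltW N0) (ltW u0)) mulrA (powRN N) mulfV// mul1r.
apply: (@le_trans _ _ (N `^ e * v `^ (- e))).
  by rewrite ler_wpM2l ?powR_ge0// le_powRN.
by rewrite ler_wpM2r ?powR_ge0// -[leRHS](powRr1 (ltW N0)) ler_powR.
Qed.

Lemma powRN1D (S e : R) : 0 < S -> S `^ (- (1 + e)) = S `^ (- e) / S.
Proof.
move=> S0; by rewrite opprD addrC gt0_powRD// (powR_inv1 (ltW S0)).
Qed.

Lemma dirichlet_weighted (d m : nat) (a : 'I_d -> R) (b : 'I_m -> R) (k : R) :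
  (forall i, 0 <= a i) -> (forall j, 0 <= b j) ->
  \sum_i a i + \sum_j b j = 1 -> 0 < \sum_i a i -> 0 < k <= 1 ->
  exists2 N : R, 1 <= N & forall (S : R) x y G, 1 <= S ->
    exists (q : nat) (p : 'I_d -> int) (p' : 'I_m -> int),
    [/\ (0 < q)%N, q%:R <= N * S,
        forall i, `|q%:R * x i - (p i)%:~R| <= k * S `^ (- a i) &
        forall j, `|q%:R * y j + \sum_i G j i * ((p i)%:~R - q%:R * x i)
                  - (p' j)%:~R| <= k * (N * S) `^ (- b j)].
Proof.
set s := \sum_i a i => a0 b0 ab s0 /andP[k0 k1].
(* The pigeonhole count is (2/k)^(d+m) S^s (NS)^(1-s) = (2/k)^(d+m) N^(-s) NS. Choosing N^s = [K]
   makes it NS/2, which is at most the integer part of NS. *)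
pose K := 2 * (2 / k) ^+ (d + m).
have k2 : 1 <= 2 / k by rewrite ler_pdivlMr//; lra.
have K1 : 1 <= K by have := exprn_ege1 (d + m) k2; rewrite /K; lra.
have K0 : 0 <= K by rewrite (le_trans _ K1).
pose N := K `^ s^-1.
have N1 : 1 <= N by rewrite -(powRr0 K) ler_powR// invr_ge0 ltW.
have Ns : N `^ s = K by rewrite -powRrM mulVf ?gt_eqF// powRr1.
exists N => // S x y G S1.
have S0 : 0 < S by exact: lt_le_trans S1.
have N0 : 0 < N by exact: lt_le_trans N1.
have NS1 : 1 <= N * S by rewrite mulr_ege1.
have NS0 : 0 < N * S by rewrite mulr_gt0.
have kpow01 (v e : R) : 1 <= v -> 0 <= e -> 0 < k * v `^ (- e) <= 1.
  move=> v1 e0; have v0 : 0 < v by exact: lt_le_trans v1.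
  have ve1 : v `^ (- e) <= 1 by rewrite -(powRr0 v) ler_powR// oppr_le0.
  by rewrite mulr_gt0 ?powR_gt0//= mulr_ile1 ?powR_ge0// ltW.
have [|||q [p [p' [/andP[q0 qM] px py]]]] := @dirichlet_triangular R d m x y G
   (fun i => k * S `^ (- a i)) (fun j => k * (N * S) `^ (- b j))
   (Num.truncn (N * S)).
- by move=> i; exact: kpow01.
- by move=> j; exact: kpow01.
- have kE (v e : R) : 2 / (k * v `^ (- e)) = 2 / k * v `^ e.
    by rewrite powRN invfM invrK mulrA.
  rewrite (eq_bigr _ (fun i _ => kE S (a i))).
  rewrite (eq_bigr _ (fun j _ => kE (N * S) (b j))).
  rewrite !prod_mul_powR// !card_ord -/s.
  have -> : \sum_j b j = 1 - s by rewrite -ab addrC addKr.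
  apply: (@le_trans _ _ (N * S / 2)).
    rewrite le_eqVlt; apply/orP; left; apply/eqP.
    rewrite mulrACA -exprD powRM ?ltW//.
    have -> : (2 / k) ^+ (d + m) = N `^ s / 2.
      by rewrite Ns /K [RHS]mulrC mulKf// pnatr_eq0.
    have NsN : N `^ s * N `^ (1 - s) = N.
      by rewrite -gt0_powRD// addrC subrK powRr1 ?ltW.
    have SsS : S `^ s * S `^ (1 - s) = S.
      by rewrite -gt0_powRD// addrC subrK powRr1 ?ltW.
    rewrite -[in RHS]NsN -[in RHS]SsS; ring.
  have /andP[_] := truncn_itv (ltW NS0).
  have : 1 <= (Num.truncn (N * S))%:R :> R by rewrite ler1n truncn_gt0.
  rewrite -natr1; lra.
exists q, p, p'; split => //.
have /andP[le _] := truncn_itv (ltW NS0).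
by apply: le_trans le; rewrite ler_nat.
Qed.

End weighted_dirichlet.

(** * Holes near badly approximable points *)

Section holes_near_bad_points.
Context (R : realType) (d m : nat).
Variables (U : set 'rV[R]_d) (f : 'rV[R]_d -> 'rV[R]_m) (tau : 'rV[R]_(d + m)).
Hypotheses (U_open : open U) (f_C2 : Ck_map_on 2 U f)
  (tau_ge0 : forall i, 0 <= tau 0 i) (tau_sum : \sum_i tau 0 i = 1)
  (tau_min_max : forall i j, tau 0 (rshift d j) <= tau 0 (lshift m i)).
Hypothesis d_gt0 : (0 < d)%N.

Let a i := tau 0 (lshift m i).
Let b j := tau 0 (rshift d j).
Let D j i x := 'D_(delta_mx 0 i) (fun x => f x 0 j) x.

(** With the constant fixed, the part of [U] mapped into [Bad tau] is the union of these sets over c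
    = 1/(n+1). *)
Definition bad_piece (c : R) : set 'rV[R]_d := [set x | U x /\
  forall (p : 'rV[int]_(d + m)) (q : nat), (0 < q)%N -> exists i,
    c * q%:R `^ (- tau 0 i) <= `|q%:R * graph_map f x 0 i - (p 0 i)%:~R| ].

Let tau_le1 i : tau 0 i <= 1.
Proof. by rewrite -tau_sum (bigD1 i)//= lerDl sumr_ge0. Qed.

Let a_ge0 i : 0 <= a i. Proof. exact: tau_ge0. Qed.
Let b_ge0 j : 0 <= b j. Proof. exact: tau_ge0. Qed.
Let ab_sum : \sum_i a i + \sum_j b j = 1.
Proof. by move: tau_sum; rewrite big_split_ord. Qed.

(** If all [a i] vanished, so would all [b j] by [tau_min_max], against the total 1. Positivity is
    what allows [dirichlet_weighted] to choose [N]. *)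
Let a_sum_gt0 : 0 < \sum_i a i.
Proof.
rewrite lt0r sumr_ge0// andbT; apply/eqP => a0.
have ai i : a i = 0 by exact: (psumr_eq0P (fun i _ => a_ge0 i) a0).
have : \sum_j b j = 0.
  apply: big1 => j _; apply/eqP; rewrite eq_le b_ge0 andbT.
  by rewrite -(ai (Ordinal d_gt0)); exact: tau_min_max.
by move=> b0; move: ab_sum; rewrite a0 b0 addr0 => /eqP; rewrite eq_sym oner_eq0.
Qed.

Let bad_split c x (p : 'I_d -> int) (p' : 'I_m -> int) (q : nat) :
  bad_piece c x -> (0 < q)%N ->
  (exists i, c * q%:R `^ (- a i) <= `|q%:R * x 0 i - (p i)%:~R|) \/
  (exists j, c * q%:R `^ (- b j) <= `|q%:R * f x 0 j - (p' j)%:~R|).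
Proof.
move=> [_ /(_ (row_mx (\row_i p i) (\row_j p' j)) q) bad] q0.
have [k] := bad q0; have [i ->|j ->] := split_ordP k.
- by rewrite /graph_map !row_mxEl mxE; left; exists i.
- by rewrite /graph_map !row_mxEr mxE; right; exists j.
Qed.

(** The radius has the form [S0^-1] since it is compared with [S^-1] for large [S]; summing inverse
    radii gives one radius for all [j]. *)
Let expansion x e : U x -> 0 < e ->
  exists2 S0, 0 < S0 & forall y : 'rV[R]_d, (forall i, `|y 0 i - x 0 i| < S0^-1) ->
    forall j, `|f y 0 j - f x 0 j - \sum_i D j i x * (y 0 i - x 0 i)|
      <= e * \sum_i `|y 0 i - x 0 i|.
Proof.
move=> Ux e0.
have /choice[r rP] (j : 'I_m) : exists r, 0 < r /\
    forall y : 'rV[R]_d, (forall i, `|y 0 i - x 0 i| < r) ->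
    `|f y 0 j - f x 0 j - \sum_i D j i x * (y 0 i - x 0 i)|
      <= e * \sum_i `|y 0 i - x 0 i|.
  have [_ fC1] := f_C2 j.
  have [i z Uz|i|r r0 rP] := @partials_expansion R d (fun x => f x 0 j) U x e
    U_open Ux e0.
  - by have [+ _] := fC1 i; apply.
  - by have [_ [+ _]] := fC1 i; apply.
  - by exists r.
have ri j : 0 < (r j)^-1 by rewrite invr_gt0; have [] := rP j.
have rsum : 0 <= \sum_j (r j)^-1 by apply: sumr_ge0 => j _; exact: ltW.
exists (1 + \sum_j (r j)^-1); first by lra.
move=> y yx j; have [r0] := rP j; apply => i; apply: lt_le_trans (yx i) _.
rewrite -[leRHS]invrK lef_pV2 ?posrE//; last by lra.
by rewrite (bigD1 j)//= addrCA lerDl addr_ge0// sumr_ge0// => *; exact: ltW.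
Qed.

Let sum_mul_le (I : finType) (g v : I -> R) (L e : R) :
  \sum_i `|g i| <= L -> 0 <= e -> (forall i, `|v i| <= e) ->
  `|\sum_i g i * v i| <= L * e.
Proof.
move=> gL e0 ve; apply: (le_trans (ler_norm_sum _ _ _)).
apply: (@le_trans _ _ ((\sum_i `|g i|) * e)); last by rewrite ler_wpM2r.
by rewrite mulr_suml; apply: ler_sum => i _; rewrite normrM ler_wpM2l.
Qed.

(** Both [eta] and [S0] depend on [x], through the size of the derivatives there and the radius of
    the expansion. One integer point is tested twice: badness at [x] bounds [q] from below, and
    badness at [x'] then keeps [x'] out of the hole. *)
Lemma bad_piece_hole c x : 0 < c -> bad_piece c x ->
  exists2 eta, 0 < eta & exists2 S0, 0 < S0 & forall S, S0 <= S ->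
    exists2 z : 'rV[R]_d,
      forall i, `|x 0 i - z 0 i| <= S `^ (- (1 + a i)) / 8 &
      forall x', bad_piece c x' ->
        exists i, eta * S `^ (- (1 + a i)) < `|x' 0 i - z 0 i|.
Proof.
move=> c0 xbad; have [Ux _] := xbad.
pose L := \sum_j \sum_i `|D j i x|.
have L0 : 0 <= L by apply: sumr_ge0 => j _; apply: sumr_ge0.
have DL j : \sum_i `|D j i x| <= L.
  by rewrite /L (bigD1 j)//= lerDl; apply: sumr_ge0 => ? _; apply: sumr_ge0.
(* The bound [8^-1] brings p/q close to [x]. The other one gives [k * (2 + L) < c], where 2 counts
   the Dirichlet form and the remainder, and [L] the derivative terms. *)
pose k := Num.min 8^-1 (c / (3 + L)).
have L3 : 0 < 3 + L by lra.
have k0 : 0 < k by rewrite lt_min divr_gt0// invr_gt0 ltr0n.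
have k8 : k <= 8^-1 by rewrite ge_min lexx.
have kc : k * (3 + L) <= c by rewrite -ler_pdivlMr// ge_min lexx orbT.
have kL0 : 0 <= k * L by rewrite mulr_ge0// ltW.
have kc2 : k * (2 + L) < c by lra.
have [|N N1 NP] := @dirichlet_weighted R d m a b k a_ge0 b_ge0 ab_sum a_sum_gt0.
  by rewrite k0/= (le_trans k8)//; lra.
have N0 : 0 < N by exact: lt_le_trans N1.
pose d1 : R := d.+1%:R.
have d1_gt0 : 0 < d1 by rewrite ltr0n.
(* One factor [N] pays for [q <= N * S], the other for replacing powers of [S] by powers of [q]. *)
pose eta := k / N ^+ 2.
have eta0 : 0 < eta by rewrite divr_gt0// exprn_gt0.
have etak : eta <= k by rewrite ler_pdivrMr ?exprn_gt0// ler_peMr ?exprn_ege1// ltW.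
have [S1 S1_gt0 fS1] := expansion Ux (divr_gt0 eta0 d1_gt0).
exists eta => //; exists (1 + S1); first by lra.
move=> S SS1; have S_ge1 : 1 <= S by lra.
have S_gt0 : 0 < S by lra.
have S1S : S1 < S by lra.
have [q [p [p' [q0 qNS px py]]]] := NP S (fun i => x 0 i) (fun j => f x 0 j)
  (fun j i => D j i x) S_ge1.
have q_ge1 : 1 <= q%:R :> R by rewrite ler1n.
have q_gt0 : 0 < q%:R :> R by rewrite ltr0n.
have NS_gt0 : 0 < N * S by rewrite mulr_gt0.
have le_ab (v : R) i j : 1 <= v -> v `^ (- a i) <= v `^ (- b j).
  by move=> v1; rewrite ler_powR// lerN2; exact: tau_min_max.
have bad_absurd e (w : R) : w <= k * (2 + L) * q%:R `^ (- e) ->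
    c * q%:R `^ (- e) <= w -> False.
  move=> w1 w2; have := le_trans w2 w1.
  by rewrite ler_pM2r ?powR_gt0// leNgt kc2.
have k_le e : k * q%:R `^ (- e) <= k * (2 + L) * q%:R `^ (- e).
  by rewrite ler_wpM2r ?powR_ge0//; lra.
(* If [q < S], all bounds in terms of [S] and [N * S] imply bounds in terms of [q], and [x] would be
   approximated too well. *)
have Sq : S <= q%:R.
  rewrite leNgt; apply/negP => qS.
  have [[i]|[j]] := bad_split p p' xbad q0.
    apply: bad_absurd; apply: le_trans (px i) (le_trans _ (k_le (a i))).
    by rewrite ler_wpM2l ?le_powRN// ltW.
  apply: bad_absurd.
  have -> : q%:R * f x 0 j - (p' j)%:~R =
      (q%:R * f x 0 j + \sum_i D j i x * ((p i)%:~R - q%:R * x 0 i) - (p' j)%:~R)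
      - \sum_i D j i x * ((p i)%:~R - q%:R * x 0 i) by ring.
  apply: (le_trans (ler_normB _ _)).
  have py' := py j.
  have sumD : `|\sum_i D j i x * ((p i)%:~R - q%:R * x 0 i)|
      <= L * (k * q%:R `^ (- b j)).
    apply: sum_mul_le (DL j) _ _; first by rewrite mulr_ge0 ?powR_ge0// ltW.
    (* The order of the weights enters here: [b j <= a i] lets errors in the first coordinates be
       absorbed in the bound for the last ones. *)
    move=> i; rewrite distrC (le_trans (px i))// ler_wpM2l ?(ltW k0)//.
    by rewrite (le_trans (le_ab _ i j S_ge1))// le_powRN// ltW.
  have kq0 : 0 <= k * q%:R `^ (- b j) by rewrite mulr_ge0 ?powR_ge0// ltW.
  have : k * (N * S) `^ (- b j) <= k * q%:R `^ (- b j).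
    by rewrite ler_wpM2l ?(ltW k0)// le_powRN.
  by rewrite mulrDr mulrDl; lra.
have x_near i : `|x 0 i - (p i)%:~R / q%:R| <= S `^ (- a i) / S / 8.
  have -> : x 0 i - (p i)%:~R / q%:R = (q%:R * x 0 i - (p i)%:~R) / q%:R.
    by rewrite mulrBl mulrAC divff ?mul1r// gt_eqF.
  rewrite normrM normfV (ger0_norm (ltW q_gt0)) ler_pdivrMr//.
  apply: (le_trans (px i)); rewrite mulrC -!mulrA ler_wpM2l ?powR_ge0//.
  rewrite (le_trans k8)// mulrCA -[leLHS]mulr1 ler_wpM2l//.
  by rewrite mulrC ler_pdivlMr// mul1r.
exists (\row_i ((p i)%:~R / q%:R)).
  by move=> i; rewrite mxE powRN1D.
move=> x' x'bad; apply: contrapT => /forallNP near_z.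
have {}near_z i : `|x' 0 i - (p i)%:~R / q%:R| <= eta * (S `^ (- a i) / S).
  by have := near_z i; rewrite mxE powRN1D// => /negP; rewrite -leNgt.
have near_p i : `|q%:R * x' 0 i - (p i)%:~R| <= k * q%:R `^ (- a i).
  have -> : q%:R * x' 0 i - (p i)%:~R = q%:R * (x' 0 i - (p i)%:~R / q%:R).
    by rewrite mulrBr mulrCA divff ?mulr1// gt_eqF.
  rewrite normrM (ger0_norm (ltW q_gt0)).
  apply: (@le_trans _ _ (N * S * (eta * (S `^ (- a i) / S)))).
    by rewrite ler_pM// ltW.
  have -> : N * S * (eta * (S `^ (- a i) / S)) = k * (S `^ (- a i) / N).
    by rewrite /eta; field; rewrite !gt_eqF.
  rewrite ler_wpM2l ?(ltW k0)// ler_pdivrMr// mulrC.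
  by apply: powRN_le_mul => //; rewrite a_ge0 tau_le1.
have x'x i : `|x' 0 i - x 0 i| <= S `^ (- a i) / S.
  have SS0 : 0 <= S `^ (- a i) / S by rewrite divr_ge0 ?powR_ge0// ltW.
  apply: (le_trans (ler_distD ((p i)%:~R / q%:R) _ _)).
  have etaS : eta * (S `^ (- a i) / S) <= 8^-1 * (S `^ (- a i) / S).
    by rewrite ler_wpM2r// (le_trans etak).
  by have := near_z i; have := x_near i; rewrite (distrC (x 0 i)); lra.
have x'x_lt i : `|x' 0 i - x 0 i| < S1^-1.
  apply: (@le_lt_trans _ _ S^-1); last by rewrite ltf_pV2.
  apply: (le_trans (x'x i)); rewrite -[leRHS]mul1r ler_wpM2r ?invr_ge0 ?(ltW S_gt0)//.
  by rewrite -(powRr0 S) ler_powR// oppr_le0.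
have [[i]|[j]] := bad_split p p' x'bad q0.
  by apply: bad_absurd; exact: le_trans (near_p i) (k_le _).
apply: bad_absurd.
have := fS1 x' x'x_lt j; set r := (X in `|X| <= _) => r_le.
(* The Dirichlet form at [x], plus the derivative applied to [q x' - p], plus [q] times the
   expansion remainder. *)
have -> : q%:R * f x' 0 j - (p' j)%:~R =
    (q%:R * f x 0 j + \sum_i D j i x * ((p i)%:~R - q%:R * x 0 i) - (p' j)%:~R)
    + \sum_i D j i x * (q%:R * x' 0 i - (p i)%:~R) + q%:R * r.
  have -> : \sum_i D j i x * (q%:R * x' 0 i - (p i)%:~R) =
      q%:R * (\sum_i D j i x * (x' 0 i - x 0 i)) -
      \sum_i D j i x * ((p i)%:~R - q%:R * x 0 i).
    by rewrite mulr_sumr -sumrB; apply: eq_bigr => i _; ring.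
  by rewrite /r; ring.
have kq0 : 0 <= k * q%:R `^ (- b j) by rewrite mulr_ge0 ?powR_ge0// ltW.
have v_le : k * (N * S) `^ (- b j) <= k * q%:R `^ (- b j).
  by rewrite ler_wpM2l ?(ltW k0)// le_powRN.
have sumD : `|\sum_i D j i x * (q%:R * x' 0 i - (p i)%:~R)|
    <= L * (k * q%:R `^ (- b j)).
  apply: sum_mul_le (DL j) kq0 _ => i.
  by rewrite (le_trans (near_p i))// ler_wpM2l ?(ltW k0)// le_ab.
have qr_le : `|q%:R * r| <= k * q%:R `^ (- b j).
  rewrite normrM (ger0_norm (ltW q_gt0)).
  (* The divisor [d1] in the precision of the expansion compensates the sum over [d]
     displacements. *)
  have r_le' : `|r| <= eta * (S `^ (- b j) / S).
    apply: (le_trans r_le); rewrite -mulrA ler_wpM2l ?(ltW eta0)//.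
    rewrite mulrC ler_pdivrMr// mulrC.
    apply: (@le_trans _ _ (\sum_(i < d) (S `^ (- b j) / S))).
      apply: ler_sum => i _; apply: (le_trans (x'x i)).
      by rewrite ler_wpM2r ?invr_ge0 ?(ltW S_gt0)// le_ab.
    rewrite sumr_const card_ord -mulr_natl ler_wpM2r ?ler_nat//.
    by rewrite divr_ge0 ?powR_ge0// ltW.
  apply: (@le_trans _ _ (N * S * (eta * (S `^ (- b j) / S)))).
    by rewrite ler_pM// ltW.
  have -> : N * S * (eta * (S `^ (- b j) / S)) = k * (S `^ (- b j) / N).
    by rewrite /eta; field; rewrite !gt_eqF.
  rewrite ler_wpM2l ?(ltW k0)// ler_pdivrMr// mulrC.
  by apply: powRN_le_mul => //; rewrite b_ge0 tau_le1.
apply: (le_trans (ler_normD _ _)); apply: (le_trans (lerD (ler_normD _ _) (lexx _))).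
have -> : k * (2 + L) * q%:R `^ (- b j) =
    2 * (k * q%:R `^ (- b j)) + L * (k * q%:R `^ (- b j)) by ring.
by have := py j; lra.
Qed.

End holes_near_bad_points.

(** * Decomposition into countably many uniformly porous pieces *)

Unset Implicit Arguments.

Theorem theorem8p1 (R : realType) (d m : nat) (d_ge1 : (1 <= d)%N)
  (m_ge1 : (1 <= m)%N) (U : set 'rV[R]_d) (U_open : open U)
  (f : 'rV[R]_d -> 'rV[R]_m) (f_C2 : Ck_map_on 2 U f)
  (tau : 'rV[R]_(d + m)) (tau_ge0 : forall i, 0 <= tau 0 i)
  (tau_sum : \sum_(i < d + m) tau 0 i = 1)
  (tau_min_max : forall (i : 'I_d) (j : 'I_m),
     tau 0 (rshift d j) <= tau 0 (lshift m i)) :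
  lebesgue_rV (U `&` graph_map f @^-1` Bad tau) = 0%E.
Proof.
case: d d_ge1 => // d _ in U U_open f f_C2 tau tau_ge0 tau_sum tau_min_max *.
pose E := bad_piece U f tau.
pose sigma i := 1 + tau 0 (lshift m i).
have sigma_ge1 i : 1 <= sigma i by rewrite lerDl.
have inv_gt0 n : 0 < n.+1%:R^-1 :> R by rewrite invr_gt0 ltr0n.
have ex_inv_le (t : R) : 0 < t -> exists n, n.+1%:R^-1 <= t.
  move=> t0; exists (Num.truncn t^-1).
  have t1 : 0 <= t^-1 by rewrite invr_ge0 ltW.
  rewrite -[leRHS]invrK lef_pV2 ?posrE ?invr_gt0 ?ltr0n//.
  by have /andP[_ /ltW] := truncn_itv t1.
apply: (@lebesgue_rV_countable_cover R d nat _ (fun n => E n.+1%:R^-1)).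
  move=> x [Ux [c c0 bad]]; have [n nc] := ex_inv_le c c0.
  exists n => //; split=> // p q q0; have [i qi] := bad p q q0.
  by exists i; apply: le_trans qi; rewrite ler_wpM2r ?powR_ge0.
move=> n; set c := n.+1%:R^-1; have c0 : 0 < c by exact: inv_gt0.
(* The constants from [bad_piece_hole] vary with the point. Bounding [eta] below by 1/(k+1) and [S0]
   above by l+1 yields pieces on which they are uniform, as porosity requires. *)
pose P (kl : nat * nat) := [set x | E c x /\ forall S, kl.2.+1%:R <= S ->
  exists2 z : 'rV[R]_d.+1,
    forall i, `|x 0 i - z 0 i| <= S `^ (- sigma i) / 8 &
    forall x', E c x' ->
      exists i, kl.1.+1%:R^-1 * S `^ (- sigma i) < `|x' 0 i - z 0 i|].
apply: (@lebesgue_rV_countable_cover R d (nat * nat)%type _ P).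
  move=> x Ex.
  have [eta eta0 [S0 S00 holes]] := bad_piece_hole U_open f_C2 tau_ge0 tau_sum
    tau_min_max (ltn0Sn d) c0 Ex.
  have [k k_eta] := ex_inv_le eta eta0.
  exists (k, Num.truncn S0) => //; split=> // S S_ge.
  have [|z xz zE] := holes S.
    have /andP[_ /ltW] := truncn_itv (ltW S00).
    by move=> /le_trans; apply.
  exists z => // x' /zE[i lti]; exists i; apply: le_lt_trans lti.
  by rewrite ler_wpM2r ?powR_ge0.
move=> [k l]; apply: (@lebesgue_rV_porous R d (P (k, l)) sigma l.+1%:R k.+1%:R^-1).
- exact: sigma_ge1.
- by rewrite ltr0n.
- exact: inv_gt0.
(* A hole that misses all of [E c] also misses its subset [P (k, l)]. *)
- move=> x S [_ holes] /holes[z xz zE]; exists z => // x' [Ex' _].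
  exact: zE.
Qed.
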